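(* Let $n,k\ge 1$ be integers, let $f:B^n\to\mathbb{R}$ be a $k$ times continuously differentiable function on $B^n$, and let a subset $Z\subset B^n$ be given. Put $L=\sup_{x\in Z}|f(x)|$. Then $$\max_{x\in B^n}|f(x)|\le \inf_{d}\,\bigl[R_d(Z)\,(L+E_d(f))+E_d(f)\bigr],$$ where the infimum is over all integers $d\ge 0$.
   Context: $B^n$ is the closed unit ball centered at the origin in $\mathbb{R}^n$. ''Polynomial of degree $d$'' means a real polynomial in $x_1,\dots,x_n$ of degree at most $d$. Remez constant: for $Z\subset B^n$ and an integer $d\ge 0$, $R_d(Z)\in[0,\infty]$ is the minimal $K$ such that $\sup_{B^n}|P|\le K\sup_Z|P|$ for every real polynomial $P$ of degree $d$; $R_d(Z)=\infty$ if no finite $K$ works. When $R_d(Z)=\infty$, any expression of the form $R_d(Z)\cdot a+b$ with $a,b\ge 0$ is read as $+\infty$ (also when $a=0$). The supremum of a nonnegative function over the empty set is $0$. Approximation error: for $d=0,1,\dots$, $E_d(f)$ is the minimum over all real polynomials $P$ of degree $d$ of $\max_{x\in B^n}|f(x)-P(x)|$. *)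

(* Defs.v *)
From mathcomp Require Import all_boot all_order all_algebra.
From mathcomp Require mpoly.
From mathcomp Require Import boolp classical_sets functions reals ereal.
From mathcomp Require Import topology normedtype derive.

Set Implicit Arguments.
Unset Strict Implicit.
Unset Printing Implicit Defensive.

Import Order.TTheory GRing.Theory Num.Theory.
Import numFieldNormedType.Exports.
(* The notations of mpoly clash with those of topology. *)
Import -(notations) mpoly.

Local Open Scope classical_set_scope.
Local Open Scope ring_scope.

(* The library norm of 'rV[R]_n is the sup norm, so the Euclidean balls are
   given by their equations; both norms induce the same topology. *)
Definition unit_ball (R : realType) (n : nat) : set 'rV[R]_n :=
  [set x | \sum_(i < n) x ord0 i ^+ 2 <= 1].

Definition open_unit_ball (R : realType) (n : nat) : set 'rV[R]_n :=
  [set x | \sum_(i < n) x ord0 i ^+ 2 < 1].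

Arguments unit_ball R n : clear implicits.
Arguments open_unit_ball R n : clear implicits.

(* [f] is of class C^k on the closed ball: all its partial derivatives of order
   at most [k] exist in the interior and extend continuously to the closed ball.
   [G [:: i_1; ...; i_m]] is the extension of d_(i_1) ... d_(i_m) f. Only the
   values of [f] on the closed ball matter. *)
Definition Ck_on_ball (R : realType) (n k : nat) (f : 'rV[R]_n -> R) : Prop :=
  exists G : seq 'I_n -> 'rV[R]_n -> R,
    [/\ forall x, unit_ball R n x -> G [::] x = f x,
        forall s, (size s <= k)%N -> {within unit_ball R n, continuous (G s)}
      & forall s i x, (size s < k)%N -> open_unit_ball R n x ->
          is_derive x (delta_mx ord0 i : 'rV[R]_n) (G s) (G (i :: s) x)].

(* The value 0 is adjoined so that the supremum over the empty set is 0. *)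
Definition sup_abs (R : realType) (n : nat) (A : set 'rV[R]_n)
    (g : 'rV[R]_n -> R) : \bar R :=
  ereal_sup (0%E |` [set (`|g x|)%:E | x in A]).

Definition peval (R : realType) (n : nat) (P : mpoly n R)
    (x : 'rV[R]_n) : R :=
  meval (fun i => x ord0 i) P.

(* [msize P] is the total degree plus one, and 0 if P = 0. *)
Definition deg_le (R : realType) (n d : nat) (P : mpoly n R) : Prop :=
  (msize P <= d.+1)%N.

(* The infimum is +oo when no finite [K] is admissible; otherwise it is attained,
   the set of admissible [K] being closed. *)
Definition remez (R : realType) (n d : nat) (Z : set 'rV[R]_n) : \bar R :=
  ereal_inf [set K%:E | K in [set K : R | 0 <= K /\
    forall P : mpoly n R, deg_le d P ->
      (sup_abs (unit_ball R n) (peval P) <= K%:E * sup_abs Z (peval P))%E]].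

(* By finite dimensionality the infimum is attained, and it is finite, as soon as
   [f] is continuous on the closed ball. *)
Definition approx_error (R : realType) (n d : nat) (f : 'rV[R]_n -> R) :
    \bar R :=
  ereal_inf [set sup_abs (unit_ball R n) (fun x => f x - peval P x)
            | P in [set P : mpoly n R | deg_le d P]].

(* r * a + b, where r = +oo gives +oo even if a = 0 (in the library
   +oo * 0 = 0). *)
Definition remez_affine (R : realType) (r a b : \bar R) : \bar R :=
  if r == +oo%E then +oo%E else (r * a + b)%E.

(* Main.v *)
(** For every admissible Remez factor [K] and every polynomial [P] of degree [d]
    with uniform error [e = max_B |f - P|],
    [|f| <= |P| + e <= K sup_Z |P| + e <= K (L + e) + e] on the ball; then take
    the infimum over [P] and over [K]. Testing the Remez inequality on the
    constant 1 gives [R_d(Z) >= 1], so that the bound is [+oo] whenever [L] or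
    [E_d(f)] is, and the conventions on [0 * +oo] never matter. *)

Require Import Defs.
From mathcomp Require Import all_boot all_order all_algebra.
From mathcomp Require Import boolp classical_sets functions reals ereal.
From mathcomp Require Import topology normedtype derive.
From mathcomp Require mpoly.
From mathcomp Require Import lra.
Import Order.TTheory GRing.Theory Num.Theory.
Import numFieldNormedType.Exports.
(* The notations of mpoly clash with those of topology. *)
Import -(notations) mpoly.
Local Open Scope classical_set_scope.
Local Open Scope ring_scope.

Set Implicit Arguments.
Unset Strict Implicit.
Unset Printing Implicit Defensive.

Section SupAbs.
Variables (R : realType) (n : nat).
Implicit Types (A Z : set 'rV[R]_n) (f g : 'rV[R]_n -> R).
Local Open Scope ereal_scope.

Lemma sup_abs_ge0 A g : 0 <= sup_abs A g.
Proof. by apply: ereal_sup_ubound; left. Qed.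

Lemma sup_abs_ge A g x : A x -> `|g x|%:E <= sup_abs A g.
Proof. by move=> Ax; apply: ereal_sup_ubound; right; exists x. Qed.

Lemma sup_abs_leP A g (b : \bar R) : 0 <= b ->
  (forall x, A x -> `|g x|%:E <= b) -> sup_abs A g <= b.
Proof.
by move=> b0 gb; apply: ge_ereal_sup => _ [->//|[x Ax <-]]; exact: gb.
Qed.

(** Pointwise [|g| <= |f| + |f - g|]. The error is taken over the larger set [A], as it is in
    [approx_error]. *)
Lemma sup_abs_triangle A Z f g : Z `<=` A ->
  sup_abs Z g <= sup_abs Z f + sup_abs A (fun x => f x - g x)%R.
Proof.
move=> ZA; apply: sup_abs_leP => [|x Zx].
  by apply: adde_ge0; exact: sup_abs_ge0.
apply: (@le_trans _ _ (`|f x|%:E + `|f x - g x|%:E)).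
  by rewrite -EFinD lee_fin -[in leLHS](subKr (f x) (g x)) ler_normB.
apply: leeD; first exact: sup_abs_ge.
exact: (@sup_abs_ge A (fun x => f x - g x)%R _ (ZA _ Zx)).
Qed.

End SupAbs.

Section Remez.
Variables (R : realType) (n d : nat).
Implicit Types (Z : set 'rV[R]_n) (f : 'rV[R]_n -> R) (P : mpoly n R).

(** Convertible to the membership condition of the set whose infimum is [remez d Z]. *)
Definition remez_admissible Z (K : R) : Prop := 0 <= K /\
  forall P, deg_le d P ->
    (sup_abs (unit_ball R n) (peval P) <= K%:E * sup_abs Z (peval P))%E.

Lemma unit_ball0 : unit_ball R n 0.
Proof.
by rewrite /unit_ball /= big1 ?ler01 // => i _; rewrite mxE expr0n.
Qed.

Lemma peval1 x : peval (1 : mpoly n R) x = 1.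
Proof. exact: meval1. Qed.

Lemma deg_le1 : deg_le d (1 : mpoly n R).
Proof. by rewrite /deg_le msize1. Qed.

Lemma remez_admissible_ge1 Z K : remez_admissible Z K -> 1 <= K.
Proof.
move=> [K0 HK]; rewrite -lee_fin.
have := sup_abs_ge (peval (1 : mpoly n R)) unit_ball0.
rewrite peval1 normr1 => /le_trans; apply.
apply: le_trans (HK _ deg_le1) _.
(* The supremum of the constant 1 over [Z] is 1, or 0 if [Z] is empty; at most 1 in both cases. *)
rewrite -[leRHS]mule1 lee_wpmul2l ?lee_fin //.
by apply: sup_abs_leP => [|x _]; rewrite ?peval1 ?normr1 ?lee_fin.
Qed.

Lemma remez_ge1 Z : (1 <= remez d Z)%E.
Proof.
apply: le_ereal_inf_tmp => _ [K /remez_admissible_ge1 K1 <-].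
by rewrite lee_fin.
Qed.

Lemma approx_error_ge0 f : (0 <= approx_error d f)%E.
Proof. by apply: le_ereal_inf_tmp => _ [P _ <-]; exact: sup_abs_ge0. Qed.

Lemma admissible_bound Z f K P x : Z `<=` unit_ball R n ->
  remez_admissible Z K -> deg_le d P -> unit_ball R n x ->
  (`|f x|%:E <=
   K%:E * (sup_abs Z f + sup_abs (unit_ball R n) (fun y => f y - peval P y)%R)
   + sup_abs (unit_ball R n) (fun y => f y - peval P y)%R)%E.
Proof.
move=> ZB [K0 HK] dP Bx.
apply: (@le_trans _ _ (`|peval P x|%:E + `|f x - peval P x|%:E)%E).
  by rewrite -EFinD lee_fin -[in leLHS](subrKC (peval P x) (f x)) ler_normD.
apply: leeD; last exact: (@sup_abs_ge _ _ _ (fun y => f y - peval P y)).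
apply: le_trans (sup_abs_ge (peval P) Bx) _; apply: le_trans (HK P dP) _.
by apply: lee_wpmul2l; [rewrite lee_fin | exact: sup_abs_triangle].
Qed.

(** Each infimum is passed by solving the inequality of [admissible_bound] for the minimised
    quantity, first the error, then [K]: this yields a lower bound of the set in question. *)
Lemma remez_affine_bound Z f x : Z `<=` unit_ball R n -> unit_ball R n x ->
  (`|f x|%:E <= remez_affine (remez d Z)
                  (sup_abs Z f + approx_error d f) (approx_error d f))%E.
Proof.
move=> ZB Bx; rewrite /remez_affine; case: eqP => [_|]; first exact: leey.
have L0 := sup_abs_ge0 Z f.
have bound K P hK dP := @admissible_bound Z f K P x ZB hK dP Bx.
have := approx_error_ge0 f; have := remez_ge1 Z.
case defr: (remez d Z) => [r| |] // r1 E0 _.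
have r0 : 0 < r by apply: lt_le_trans ltr01 _; rewrite -lee_fin.
case defE: (approx_error d f) E0 => [E| |] // E0; last first.
  apply: (le_trans (leey _)).
  by rewrite leeDr // mule_ge0 ?adde_ge0 // lee_fin ltW.
(* If [L] is infinite, so is the right side, because [r > 0]. *)
case defL: (sup_abs Z f) L0 bound => [L| |] // L0 bound; last first.
  by rewrite addye // gt0_muley ?lte_fin // addye // leey.
rewrite !lee_fin in r1 E0 L0.
have boundK K : remez_admissible Z K -> `|f x| <= K * (L + E) + E.
  move=> hK; have K1 := remez_admissible_ge1 hK.
  have K10 : 0 < K + 1 by lra.
  (* This is [|f x| <= K * (L + e) + e] solved for [e]. *)
  suff : (((`|f x| - K * L) / (K + 1))%:E <= approx_error d f)%E.
    by rewrite defE lee_fin ler_pdivrMr //; lra.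
  apply: le_ereal_inf_tmp => _ [P dP <-]; have := bound K P hK dP.
  have := sup_abs_ge0 (unit_ball R n) (fun x => f x - peval P x).
  case: sup_abs => [e| |] // _; last by rewrite leey.
  by rewrite -EFinD !lee_fin ler_pdivrMr //; lra.
rewrite -EFinD lee_fin.
(* Solving for [K] divides by [L + E]. If this sum vanishes, any single admissible [K] suffices. *)
have [LE0|LE0] := leP (L + E) 0.
  have {}LE0 : L + E = 0 by lra.
  (* One exists, since the infimum of the empty set is [+oo] while [remez d Z] is finite. *)
  have [K hK] : exists K, remez_admissible Z K.
    apply: contrapT => noK.
    suff : remez d Z = +oo%E by rewrite defr.
    rewrite /remez (_ : [set _ | _ in _] = set0) ?ereal_inf0 //.
    by rewrite -subset0 => y [K hK _]; apply: noK; exists K.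
  by have := boundK K hK; rewrite LE0 !mulr0.
suff : (((`|f x| - E) / (L + E))%:E <= remez d Z)%E.
  by rewrite defr lee_fin ler_pdivrMr //; lra.
apply: le_ereal_inf_tmp => _ [K hK <-].
by rewrite lee_fin ler_pdivrMr //; have := boundK K hK; lra.
Qed.

End Remez.

Theorem theorem1p3 (R : realType) (n k : nat) (hn : (1 <= n)%N)
    (hk : (1 <= k)%N) (f : 'rV[R]_n -> R) (hf : Ck_on_ball k f)
    (Z : set 'rV[R]_n) (hZ : Z `<=` unit_ball R n) :
  (sup_abs (unit_ball R n) f <=
   ereal_inf [set remez_affine (remez d Z)
                    (sup_abs Z f + approx_error d f) (approx_error d f)
             | d in [set: nat]])%E.
Proof.
have bound d x Bx := @remez_affine_bound R n d Z f x hZ Bx.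
apply: le_ereal_inf_tmp => _ [d _ <-]; apply: sup_abs_leP => [|x Bx].
  (* The bound is nonnegative since it dominates [|f 0|]; this handles the value 0 adjoined in
     [sup_abs]. *)
  exact: le_trans (bound d 0 (unit_ball0 R n)).
exact: bound.
Qed.
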